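(* For all discretization parameters $\varepsilon=(h,\delta,\theta)$ there exists a unique $u_\varepsilon\in\mathbb V_h$ that solves the discrete problem $$T_\varepsilon[u_\varepsilon;f](x_i)=0\quad\forall x_i\in\mathcal N_h^0,\qquad u_\varepsilon(x_i)=f(x_i)\quad\forall x_i\in\mathcal N_h^b .$$ The solution $u_\varepsilon$ is stable in the sense that $\|u_\varepsilon\|_{L^\infty(\Omega_h)}\le\|f\|_{L^\infty(\Omega)}$, regardless of the parameters $\varepsilon=(h,\delta,\theta)$ of the method.
   Context: $\Omega\subset\mathbb R^d$ is a bounded, strictly convex open set and $f\in C(\overline\Omega)$. $\mathcal T_h$ is a shape-regular, quasi-uniform conforming mesh of closed simplices $T$ with mesh size $h$. $\Omega_h$ is the interior of the union of the elements $T\in\mathcal T_h$; $\mathcal N_h$ is the set of nodes (vertices) of $\mathcal T_h$, $\mathcal N_h^b:=\{x_i\in\mathcal N_h: x_i\in\partial\Omega\}$ the boundary nodes and $\mathcal N_h^0:=\mathcal N_h\setminus\mathcal N_h^b$ the interior nodes. The nodes lying on $\partial\Omega_h$ are required to lie on $\partial\Omega$, and $\Omega_h\subset\Omega$ is convex. $\mathbb V_h$ is the space of continuous piecewise linear functions over $\mathcal T_h$. $\mathbb S$ is the unit sphere of $\mathbb R^d$, and $\mathbb S_\theta\subset\mathbb S$ is a finite set such that for every $v\in\mathbb S$ there is $v^\theta\in\mathbb S_\theta$ with $|v-v^\theta|\le\theta$. The coarse scale is $\delta\ge h$, and for $x_i\in\mathcal N_h^0$, $\delta_i:=\min\{\delta,\mathrm{dist}(x_i,\partial\Omega_h)\}$.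 For $w\in C(\overline{\Omega}_h)$, $x_i\in\mathcal N_h^0$, $v\in\mathbb S$, $$\nabla^2_\delta w(x_i;v):=\frac{w(x_i+\delta_i v)-2w(x_i)+w(x_i-\delta_i v)}{\delta_i^2}.$$ For $w_h\in\mathbb V_h$ and $x_i\in\mathcal N_h^0$, $$T_\varepsilon[w_h;f](x_i):=\min\Big\{f(x_i)-w_h(x_i),\ \min_{v\in\mathbb S_\theta}\nabla^2_\delta w_h(x_i;v)\Big\}.$$ *)

(* Defs.v *)
From HB Require Import structures.
From mathcomp Require Import all_boot all_order all_algebra finmap.
From mathcomp Require Import all_classical all_reals all_analysis.

Set Implicit Arguments.
Unset Strict Implicit.
Unset Printing Implicit Defensive.

Import Order.TTheory GRing.Theory Num.Theory.
Import numFieldNormedType.Exports.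

Local Open Scope classical_set_scope.
Local Open Scope ring_scope.

Section Euclidean.
Context {R : realType} {d : nat}.
Implicit Types (x y v : 'rV[R]_d) (A : set 'rV[R]_d) (g : 'rV[R]_d -> R).

(* The norm that the library puts on 'rV[R]_d is the maximum norm.  It induces
   the usual topology and bounded sets, but |v|, the unit sphere, distances,
   diameters and inradii have to be taken in the Euclidean norm. *)
Definition enorm v : R := Num.sqrt (\sum_(j < d) v 0 j ^+ 2).

Definition unit_sphere : set 'rV[R]_d := [set v | enorm v = 1].

Definition euclidean_dist x A : R := inf [set enorm (x - y) | y in A].

Definition ediam A : R := sup [set enorm (x - y) | x in A & y in A].

Definition inradius A : R :=
  sup [set r | 0 <= r /\ exists c, [set x | enorm (x - c) <= r] `<=` A].

Definition boundary A : set 'rV[R]_d := closure A `\` interior A.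

Definition strictly_convex A : Prop :=
  forall x y (t : R), closure A x -> closure A y -> x != y ->
    0 < t -> t < 1 -> interior A (t *: x + (1 - t) *: y).

Definition box (a b : 'rV[R]_d) : set 'rV[R]_d :=
  [set x | forall j, a 0 j <= x 0 j <= b 0 j].

(* A has zero d-dimensional Lebesgue (outer) measure. *)
Definition lebesgue_null A : Prop :=
  forall e : R, 0 < e -> exists a b : nat -> 'rV[R]_d,
    [/\ forall k j, a k 0 j <= b k 0 j,
        A `<=` \bigcup_k box (a k) (b k) &
        (\sum_(0 <= k <oo) (\prod_(j < d) (b k 0 j - a k 0 j))%:E <= e%:E)%E].

(* The norm of L^oo(A): the least essential bound of |g| on A (+oo if none). *)
Definition Linf_norm A g : \bar R :=
  ereal_inf [set M%:E | M in [set M : R |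
    0 <= M /\ lebesgue_null (A `&` [set x | M < `|g x|])]].

End Euclidean.

Section Mesh.
Context {R : realType} {d : nat}.

Definition simplex (n : nat) (p : 'I_n -> 'rV[R]_d) (K : {set 'I_n}) :
    set 'rV[R]_d :=
  [set x | exists c : 'I_n -> R,
    [/\ forall i, 0 <= c i, forall i, i \notin K -> c i = 0,
        \sum_i c i = 1 & x = \sum_i c i *: p i]].

Definition affinely_independent (n : nat) (p : 'I_n -> 'rV[R]_d)
    (K : {set 'I_n}) : Prop :=
  forall c : 'I_n -> R, (forall i, i \notin K -> c i = 0) ->
    \sum_i c i = 0 -> \sum_i c i *: p i = 0 -> forall i, c i = 0.

End Mesh.

(* An element T is represented by the set K of (the indices of) its d + 1
   vertices, so that T = simplex node K.  Two elements meet in a common face,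
   which may be empty since simplex node set0 = set0. *)
Record mesh (R : realType) (d : nat) := Mesh {
  nnodes : nat;
  node : 'I_nnodes -> 'rV[R]_d;
  elts : {set {set 'I_nnodes}};
  node_inj : injective node;
  elt_card : forall K, K \in elts -> #|K| = d.+1;
  elt_indep : forall K, K \in elts -> affinely_independent node K;
  elt_conforming : forall K L, K \in elts -> L \in elts ->
    exists2 F : {set 'I_nnodes}, F \subset K :&: L &
      simplex node K `&` simplex node L = simplex node F;
  node_in_elt : forall i, exists2 K, K \in elts & i \in K
}.

Section Discretization.
Context {R : realType} {d : nat}.
Variable m : mesh R d.

Definition elt (K : {set 'I_(nnodes m)}) : set 'rV[R]_d := simplex (node (m:=m)) K.

Definition mesh_size : R := \big[Num.max/0]_(K in elts m) ediam (elt K).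

Definition shape_regular (sigma : R) : Prop :=
  forall K, K \in elts m -> ediam (elt K) <= sigma * inradius (elt K).

Definition quasi_uniform (c : R) : Prop :=
  forall K, K \in elts m -> mesh_size <= c * ediam (elt K).

Definition Omega_h : set 'rV[R]_d :=
  interior (\bigcup_(K in [set K | K \in elts m]) elt K).

Definition boundary_node (Omega : set 'rV[R]_d) (i : 'I_(nnodes m)) : Prop :=
  boundary Omega (node i).

Definition interior_node (Omega : set 'rV[R]_d) (i : 'I_(nnodes m)) : Prop :=
  ~ boundary_node Omega i.

(* Functions of V_h live on the closure of Omega_h; they are represented by
   functions on the whole space, whose values elsewhere are irrelevant. *)
Definition V_h (w : 'rV[R]_d -> R) : Prop :=
  {within closure Omega_h, continuous w} /\
  forall K, K \in elts m -> exists (a : 'cV[R]_d) (b : R),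
    forall x, elt K x -> w x = (x *m a) 0 0 + b.

Definition delta_node (delta : R) (i : 'I_(nnodes m)) : R :=
  Num.min delta (euclidean_dist (node i) (boundary Omega_h)).

Definition nabla2 (delta : R) (w : 'rV[R]_d -> R) (i : 'I_(nnodes m))
    (v : 'rV[R]_d) : R :=
  (w (node i + delta_node delta i *: v) - 2 * w (node i)
    + w (node i - delta_node delta i *: v)) / delta_node delta i ^+ 2.

(* The minimum of f(x_i) - w(x_i) and of all the nabla2(x_i; v), v in S. *)
Definition T_eps (delta : R) (S : {fset 'rV[R]_d}) (w f : 'rV[R]_d -> R)
    (i : 'I_(nnodes m)) : R :=
  \big[Num.min/f (node i) - w (node i)]_(v <- S) nabla2 delta w i v.

Definition discrete_solution (Omega : set 'rV[R]_d) (delta : R)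
    (S : {fset 'rV[R]_d}) (f u : 'rV[R]_d -> R) : Prop :=
  [/\ V_h u,
      forall i, interior_node Omega i -> T_eps delta S u f i = 0 &
      forall i, boundary_node Omega i -> u (node i) = f (node i)].

End Discretization.

(* Main.v *)
Require Import Defs.
From mathcomp Require Import all_boot all_order all_algebra finmap.
From mathcomp Require Import all_classical all_reals all_analysis.
From mathcomp Require Import measurable_realfun.
From mathcomp Require Import ring lra.
Import Order.TTheory GRing.Theory Num.Theory.
Import numFieldNormedType.Exports.
Local Open Scope classical_set_scope.
Local Open Scope ring_scope.

(** A function of the finite element space is determined by its nodal values,
    and every choice of nodal values is attained ([V_h_interpolantE],
    [V_h_interpolant]): barycentric coordinates are affine and agree on common
    faces.  At an interior node the equation says that the central value is the
    minimum of [f] and of the averages of [u] over the pairs of stencil ends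
    (lemma [discrete_solutionE]).  For this the stencil must lie in the closure of
    the discrete domain and its radius must be positive ([stencil_in_union],
    [delta_node_gt0]); an interior node lies in the open discrete domain because
    boundary nodes of that domain lie on the boundary of [Omega].  Stencil ends
    are convex combinations of nodes, so the solutions are the fixed points of
    a monotone map on vectors of nodal values.

    Existence is the Knaster-Tarski argument applied to the subsolutions of that
    map ([obstacle_step_fixpoint]).  Uniqueness is a comparison principle
    ([obstacle_step_comparison]): the interpolant of [|x|^2] is strictly
    subharmonic for every stencil, by Jensen's inequality and the parallelogram
    identity ([enorm_sqr_stencil]), and serves as a strict perturbation.

    For stability, a solution is at most [f] at the nodes, and at least any
    constant below all nodal values of [f] by comparison; so it is bounded by
    the largest [|f|] at a node, on the nodes and hence on every element.  A node
    may lie on the boundary of [Omega], and the norm of [f] is an essential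
    supremum over [Omega]; that it dominates [|f|] at the nodes rests on the
    continuity of [f] up to the boundary and on the fact that nonempty open
    sets are not Lebesgue null ([open_lebesgue_null]), which comes from the
    volume bound for coverings by boxes ([volume_le_cover_volume]). *)

(** * Coverings by boxes and null sets *)

Section CoverVolume.
Context {R : realType}.

(** Slicing along the last coordinate reduces the dimension by one.  For [t]
    in the last side of the big box, the boxes whose last side contains [t]
    cover the slice at height [t], so by induction their slices have total
    volume at least that of the slice; integrating over [t] with monotone
    convergence gives the bound.  The index predicate [P] is there for the
    induction: it selects the boxes that meet the slice.  Points are indexed by
    [nat], so that all dimensions share one type of point. *)
Lemma volume_le_cover_volume (d : nat) (lo hi : nat -> R) (a b : nat -> nat -> R)
    (P : pred nat) :
  (forall j, lo j <= hi j) -> (forall k j, a k j <= b k j) ->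
  (forall x : nat -> R, (forall j, (j < d)%N -> lo j <= x j <= hi j) ->
    exists2 k, P k & forall j, (j < d)%N -> a k j <= x j <= b k j) ->
  ((\prod_(j < d) (hi j - lo j))%:E <=
   \sum_(0 <= k <oo | P k) (\prod_(j < d) (b k j - a k j))%:E)%E.
Proof.
move=> lohi; elim: d a b P => [|d IH] a b P ab cover.
  have [k Pk _] := cover (fun=> 0) (fun j j0 => ltac:(by [])).
  rewrite big_ord0; under eq_eseriesr do rewrite big_ord0.
  apply: le_trans (nneseries_lim_ge k.+1 _); last by move=> *; rewrite lee_fin.
  by rewrite big_mkcond big_nat_recr //= Pk leeDr // sume_ge0 // => i _; case: ifP.
pose V k : R := \prod_(j < d) (b k j - a k j).
have V0 k : 0 <= V k by apply: prodr_ge0 => j _; rewrite subr_ge0.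
pose I k := [set` `[a k d, b k d]] : set R.
pose D := [set` `[lo d, hi d]] : set R.
have mD : measurable D by exact: measurable_itv.
have mI k : measurable (I k) by exact: measurable_itv.
have len (x y : R) : x <= y -> lebesgue_measure [set` `[x, y]] = (y - x)%:E.
  by rewrite le_eqVlt lebesgue_measure_itv/= lte_fin => /predU1P[->|->];
    rewrite ?ltxx ?subrr.
(* The contribution of box k to the volume of the slice at height t. *)
pose g (k : nat) (t : R) : \bar R := if P k then (V k * \1_(I k) t)%:E else 0%E.
have g0 k t : (0 <= g k t)%E.
  by rewrite /g; case: ifP => // _; rewrite lee_fin mulr_ge0.
have mg k : measurable_fun D (g k).
  rewrite /g; case: (P k) => //.
  apply/measurable_EFinP; apply: measurable_funM => //.
have slice t : D t -> ((\prod_(j < d) (hi j - lo j))%:E <= \sum_(k <oo) g k t)%E.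
  rewrite /D /= in_itv /= => Dt.
  have -> : (\sum_(k <oo) g k t =
      \sum_(0 <= k <oo | P k && (a k d <= t <= b k d)%R) (V k)%:E)%E.
    rewrite [RHS]eseries_mkcond; apply: eq_eseriesr => k _; rewrite /g.
    case: (P k) => //=; rewrite indicE mem_setE in_itv /=.
    by case: ifP => _; rewrite ?mulr1 ?mulr0.
  apply: IH => // x hx.
  have [|k Pk hk] := cover (fun j => if (j == d)%N then t else x j).
    move=> j; rewrite ltnS leq_eqVlt; case: eqVneq => [-> //|_ /=]; exact: hx.
  exists k; first by have := hk d (ltnSn d); rewrite eqxx Pk.
  by move=> j jd; have := hk j (ltnW jd); rewrite (ltn_eqF jd).
have intg k : (\int[lebesgue_measure]_(t in D) g k t <=
    if P k then (V k * (b k d - a k d))%:E else 0)%E.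
  rewrite /g; case: (P k) => /=; last by rewrite integral0.
  under eq_integral do rewrite EFinM.
  rewrite ge0_integralZl_EFin //; last first.
    by apply/measurable_EFinP; apply: measurable_indic; exact: mI.
  rewrite integral_indic; [|exact: mD|exact: mI].
  rewrite EFinM lee_wpmul2l ?lee_fin // -len //.
  by apply: le_measure; rewrite ?inE //; apply: measurableI; [exact: mI|exact: mD].
rewrite big_ord_recr /= EFinM -[(hi d - lo d)%:E]len //.
apply: (@le_trans _ _ (\int[lebesgue_measure]_(t in D) (\sum_(k <oo) g k t))%E).
  rewrite -integral_cst //; apply: ge0_le_integral => //.
    by move=> t _; rewrite lee_fin prodr_ge0 // => j _; rewrite subr_ge0.
  by apply: ge0_emeasurable_sum => *; [exact: g0|exact: mg].
rewrite integral_nneseries // [leRHS]eseries_mkcond.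
apply: lee_nneseries => [k _ _|k _]; first exact: integral_ge0.
by apply: le_trans (intg k) _; case: (P k) => //; rewrite big_ord_recr.
Qed.

End CoverVolume.

Section NullSets.
Context {R : realType}.

Lemma rV_ball_coord {d} (x y : 'rV[R]_d) (r : R) :
  0 < r -> (forall j, `|x 0 j - y 0 j| < r) -> ball x r y.
Proof. by move=> r0 xy; split=> // i j; rewrite ord1; exact: xy. Qed.

(** Extension by zero of the coordinates to all of [nat], the form in which
    boxes enter the covering bound. *)
Definition coord {d} (x : 'rV[R]_d) (j : nat) : R := oapp (x 0) 0 (insub j).

Lemma coord_ord {d} (x : 'rV[R]_d) (j : 'I_d) : coord x j = x 0 j.
Proof. by rewrite /coord valK. Qed.

(** A nonempty open set contains a cube, and the total volume of boxes that
    cover the cube cannot drop below the volume of the cube. *)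
Lemma open_lebesgue_null (d : nat) (A : set 'rV[R]_d) :
  open A -> lebesgue_null A -> A = set0.
Proof.
move=> oA nullA; apply/seteqP; split => // y Ay; exfalso.
have /nbhs_ballP[r /= r0 yrA] : nbhs y A by exact: open_nbhs_nbhs.
(* Half the volume of the cube of side r centred at y. *)
pose e := (r ^+ d) / 2.
have e0 : 0 < e by rewrite divr_gt0 ?exprn_gt0.
have [a [b [ab cover vol]]] := nullA _ e0.
pose lo j := coord y j - r / 2; pose hi j := coord y j + r / 2.
have boxle : ((\prod_(j < d) (hi j - lo j))%:E <=
    \sum_(0 <= k <oo) (\prod_(j < d) (coord (b k) j - coord (a k) j))%:E)%E.
  apply: (volume_le_cover_volume d lo hi (fun k => coord (a k)) (fun k => coord (b k)) xpredT).
  - by move=> j; rewrite /lo /hi; lra.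
  - by move=> k j /=; rewrite /coord; case: insubP => [i _ _|_] /=.
  - move=> x xlohi.
    have [|k _ xk] := cover (\row_j x j).
      apply: yrA; apply: rV_ball_coord => // j; rewrite mxE -coord_ord.
      have := xlohi j (ltn_ord j); rewrite /lo /hi ltr_norml; lra.
    by exists k => // j jd; have := xk (Ordinal jd); rewrite mxE -!coord_ord.
have volk k : \prod_(j < d) (coord (b k) j - coord (a k) j) =
    \prod_(j < d) (b k 0 j - a k 0 j).
  by apply: eq_bigr => j _; rewrite !coord_ord.
move: boxle; under eq_eseriesr do rewrite volk.
move=> /le_trans /(_ vol); rewrite lee_fin.
rewrite (eq_bigr (fun=> r)) => [|j _]; last by rewrite /hi /lo; lra.
rewrite prodr_const card_ord => rd.
by have := e0; move: rd; rewrite /e; lra.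
Qed.

End NullSets.

(** * Monotone obstacle iteration on finitely many unknowns *)

Section ObstacleIteration.
Context {R : realType}.

Lemma bigmin_seqP {V : eqType} (s : seq V) (x c : R) (F : V -> R) :
  c <= \big[Num.min/x]_(v <- s) F v <->
  c <= x /\ forall v, v \in s -> c <= F v.
Proof.
elim: s => [|w s IH]; first by rewrite big_nil; split=> [|[]].
rewrite big_cons le_min; split=> [/andP[cw /IH[cx cs]]|[cx cs]].
  by split=> // v; rewrite inE => /predU1P[->//|/cs].
by rewrite cs ?mem_head //=; apply/IH; split=> // v vs; rewrite cs // inE vs orbT.
Qed.

Lemma bigmin_seq_leP {V : eqType} (s : seq V) (x c : R) (F : V -> R) :
  \big[Num.min/x]_(v <- s) F v <= c <->
  x <= c \/ exists2 v, v \in s & F v <= c.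
Proof.
elim: s => [|w s IH]; first by rewrite big_nil; split=> [|[//|[]]]; [left|].
rewrite big_cons ge_min; split=> [/orP[wc|/IH[xc|[v vs vc]]]|[xc|[v]]].
- by right; exists w; rewrite ?mem_head.
- by left.
- by right; exists v; rewrite // inE vs orbT.
- by apply/orP; right; apply/IH; left.
- rewrite inE => /predU1P[->->//|vs vc].
  by apply/orP; right; apply/IH; right; exists v.
Qed.

Context {n : nat} {V : eqType} (inner : 'I_n -> Prop) (s : seq V)
  (W : 'I_n -> V -> 'I_n -> R) (f : 'I_n -> R).
Hypothesis W_ge0 : forall i v j, inner i -> v \in s -> 0 <= W i v j.
Hypothesis W_sum1 : forall i v, inner i -> v \in s -> \sum_j W i v j = 1.

(** The scheme solved for its central value: [u] is a discrete solution iff it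
    is a fixed point.  The weights [W i v] average the two ends of the stencil
    at node [i] in direction [v], and [f] is the obstacle (and the boundary
    value). *)
Definition obstacle_step (u : 'I_n -> R) (i : 'I_n) : R :=
  if `[< inner i >] then \big[Num.min/f i]_(v <- s) \sum_j W i v j * u j
  else f i.

Lemma obstacle_step_mono (u w : 'I_n -> R) :
  (forall i, u i <= w i) -> forall i, obstacle_step u i <= obstacle_step w i.
Proof.
move=> uw i; rewrite /obstacle_step; case: asboolP => // ii.
apply/bigmin_seqP; split=> [|v vs]; first by apply/bigmin_seq_leP; left.
apply/bigmin_seq_leP; right; exists v => //.
by apply: ler_sum => j _; rewrite ler_wpM2l // W_ge0.
Qed.

Lemma obstacle_step_le (u : 'I_n -> R) i : obstacle_step u i <= f i.
Proof.
by rewrite /obstacle_step; case: asboolP => // _; apply/bigmin_seq_leP; left.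
Qed.

Lemma obstacle_step_cst (c : R) :
  (forall i, c <= f i) -> forall i, c <= obstacle_step (fun=> c) i.
Proof.
move=> cf i; rewrite /obstacle_step; case: asboolP => // ii.
apply/bigmin_seqP; split=> // v vs.
by rewrite -mulr_suml W_sum1 // mul1r.
Qed.

(** Knaster-Tarski: the step is monotone, so the pointwise supremum of all
    subsolutions is a fixed point.  Subsolutions are bounded above by [f], and
    a very negative constant is one. *)
Lemma obstacle_step_fixpoint : exists u, forall i, obstacle_step u i = u i.
Proof.
pose P := [set w | forall i, w i <= obstacle_step w i].
pose u i := sup [set w i | w in P].
pose c := - \sum_i `|f i|.
have Pc : P (fun=> c).
  apply: obstacle_step_cst => i; rewrite /c lerNl.
  apply: (@le_trans _ _ `|f i|); first by rewrite -normrN ler_norm.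
  by rewrite (bigD1 i) //= lerDl sumr_ge0.
have Pu w : P w -> forall i, w i <= u i.
  move=> Pw i; apply: ub_le_sup; last by exists w.
  by exists (f i) => _ [w' Pw' <-]; apply: le_trans (Pw' i) (obstacle_step_le _ _).
have uG : P u.
  move=> i; apply: ge_sup; first by exists c, (fun=> c).
  by move=> _ [w Pw <-]; apply: le_trans (Pw i) _; apply/obstacle_step_mono/Pu.
exists u => i; apply/le_anti/andP; split; last exact: uG.
by apply: (Pu (obstacle_step u)); apply: obstacle_step_mono.
Qed.

(** Comparison of a subsolution [w] and a supersolution [u].  The function [q]
    is strictly subharmonic for every stencil.  If [w - u] were positive
    somewhere, it would also be positive at a maximum point of [w - u + e q] for
    small [e]; that point can lie neither on the boundary nor in the contact set, so
    the average of [w - u] along some direction is at least its value there,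
    and [e q] makes the average of [w - u + e q] exceed its maximum. *)
Lemma obstacle_step_comparison (q w u : 'I_n -> R) :
  (forall i v, inner i -> v \in s -> q i < \sum_j W i v j * q j) ->
  (forall i, w i <= obstacle_step w i) -> (forall i, obstacle_step u i <= u i) ->
  forall i, w i <= u i.
Proof.
move=> q_sub wG uG k; rewrite leNgt; apply/negP => uw.
pose C := \sum_j `|q j - q k|.
have C0 : 0 <= C by apply: sumr_ge0.
(* Small enough for the perturbation e q to change differences of values by
   less than w k - u k. *)
pose e := (w k - u k) / (C + 1).
have e0 : 0 < e by rewrite divr_gt0 ?subr_gt0 // ltr_wpDl.
pose z i := (w i - u i) + e * q i.
have [i _ imax] := @arg_maxP _ _ _ k predT z isT.
have zi_gt0 : 0 < w i - u i.
  have zki : z k <= z i by exact: imax.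
  have qik : q i - q k <= C.
    apply: le_trans (ler_norm _) _.
    by rewrite /C (bigD1 i) //= lerDl sumr_ge0.
  have ek : e * (C + 1) = w k - u k by rewrite divfK // gt_eqF // ltr_wpDl.
  have : e * (q i - q k) <= e * C by rewrite ler_pM2l.
  move: zki; rewrite /z; lra.
have := uG i; rewrite {1}/obstacle_step; case: asboolP => [ii|_] Gi; last first.
  by have := le_trans (wG i) (obstacle_step_le w i); lra.
case/bigmin_seq_leP: Gi => [fu|[v vs avg]].
  by have := le_trans (wG i) (obstacle_step_le w i); lra.
have := wG i; rewrite {1}/obstacle_step (asboolT ii) => /bigmin_seqP[_ /(_ v vs)] wavg.
have zavg : \sum_j W i v j * z j <= z i.
  rewrite -[leRHS]mul1r -(W_sum1 i v ii vs) mulr_suml; apply: ler_sum => j _.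
  by rewrite ler_wpM2l ?W_ge0 //; exact: imax.
have zE : \sum_j W i v j * z j =
    \sum_j W i v j * w j - \sum_j W i v j * u j + e * \sum_j W i v j * q j.
  rewrite mulr_sumr -sumrB -big_split /=; apply: eq_bigr => j _; rewrite /z; ring.
have := q_sub i v ii vs; rewrite -(ltr_pM2l e0) => qi.
move: zavg; rewrite zE /z; lra.
Qed.

End ObstacleIteration.

(** * Segments, balls and boundaries in Euclidean space *)

Section EuclideanGeometry.
Context {R : realType} {d : nat}.
Implicit Types (x y v : 'rV[R]_d) (A : set 'rV[R]_d).

Lemma coord_le_enorm v j : `|v 0 j| <= enorm v.
Proof.
rewrite /enorm -sqrtr_sqr ler_wsqrtr // (bigD1 j) //= lerDl.
by apply: sumr_ge0 => i _; exact: sqr_ge0.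
Qed.

Lemma enorm_ge0 v : 0 <= enorm v.
Proof. exact: sqrtr_ge0. Qed.

Lemma enormZ (s : R) v : enorm (s *: v) = `|s| * enorm v.
Proof.
rewrite /enorm -sqrtr_sqr -sqrtrM ?sqr_ge0 // mulr_sumr.
by congr Num.sqrt; apply: eq_bigr => j _; rewrite mxE exprMn.
Qed.

Lemma coord_le_norm v j : `|v 0 j| <= `|v|.
Proof.
rewrite [leRHS]/Num.Def.normr /= mx_normrE.
by apply/bigmax_geP; right => /=; exists (0, j).
Qed.

Lemma enorm_le_norm v : enorm v <= Num.sqrt d%:R * `|v|.
Proof.
rewrite -[leRHS]ger0_norm ?mulr_ge0 ?sqrtr_ge0 // -sqrtr_sqr ler_wsqrtr //.
rewrite exprMn sqr_sqrtr ?ler0n // mulr_natl -[X in _ *+ X](card_ord d) -sumr_const.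
apply: ler_sum => j _; rewrite -real_normK ?num_real //.
by rewrite ler_sqr ?nnegrE // coord_le_norm.
Qed.

Lemma enorm_sqr (v : 'rV[R]_d) : enorm v ^+ 2 = \sum_j v 0 j ^+ 2.
Proof. by rewrite sqr_sqrtr // sumr_ge0 // => j _; exact: sqr_ge0. Qed.

(** Jensen's inequality for the square: the difference of the two sides is the
    variance. *)
Lemma sqr_mean_le {n : nat} (c y : 'I_n -> R) : (forall j, 0 <= c j) ->
  \sum_j c j = 1 -> (\sum_j c j * y j) ^+ 2 <= \sum_j c j * y j ^+ 2.
Proof.
move=> c0 c1; have [a aE] : exists a, a = \sum_j c j * y j by eexists.
rewrite -aE -subr_ge0.
have -> : \sum_j c j * y j ^+ 2 - a ^+ 2 = \sum_j c j * (y j - a) ^+ 2.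
  transitivity (\sum_j c j * y j ^+ 2 - 2 * a * (\sum_j c j * y j) + a ^+ 2 * \sum_j c j).
    by rewrite c1 -aE; ring.
  rewrite !mulr_sumr -sumrB -big_split /=; apply: eq_bigr => j _; ring.
by apply: sumr_ge0 => j _; rewrite mulr_ge0 ?sqr_ge0.
Qed.

Lemma continuous_line x v : continuous (fun s : R => x + s *: v).
Proof.
move=> s; apply: cvgD; first exact: cvg_cst.
by apply: cvgZr_tmp; exact: cvg_id.
Qed.

(** The last parameter up to which the segment returns to [A] gives a point
    that is in the closure of [A], and not in [A] since [A] is open. *)
Lemma segment_meets_boundary A x v (t : R) :
  open A -> A x -> 0 <= t -> ~ closure A (x + t *: v) ->
  exists s, [/\ 0 <= s, s < t & boundary A (x + s *: v)].
Proof.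
move=> oA Ax t0 nAt.
pose E := [set s : R | 0 <= s <= t /\ A (x + s *: v)].
have E0 : E 0 by rewrite /E /= lexx t0 scale0r addr0.
have ubE : ubound E t by move=> s [/andP[]].
have s0_ge0 : 0 <= sup E by apply: ub_le_sup => //; exists t.
have s0_le : sup E <= t by apply: ge_sup => //; exists 0.
have clA : closure A (x + sup E *: v).
  move=> N /continuous_line Ns.
  have [s [[_ As] Ns']] := @closure_sup _ E (ex_intro _ _ E0) (ex_intro _ _ ubE) _ Ns.
  by exists (x + s *: v).
have s0_lt : sup E < t.
  by rewrite lt_neqAle s0_le andbT; apply/eqP => s0t; apply: nAt; rewrite -s0t.
exists (sup E); split=> //; split=> // /interior_subset As0.
have /nbhs_ballP[e /= e0 se] : nbhs (sup E) [set s : R | A (x + s *: v)].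
  by apply: (@continuous_line x v (sup E)); exact: open_nbhs_nbhs.
pose s1 := Num.min t (sup E + e / 2).
have s1_gt : sup E < s1 by rewrite lt_min s0_lt ltrDl divr_gt0.
have : s1 <= sup E.
  apply: ub_le_sup; first by exists t.
  split; first by rewrite (le_trans s0_ge0 (ltW s1_gt)) ge_min lexx.
  apply: se; rewrite /ball /= ltr_norml.
  have : s1 <= sup E + e / 2 by rewrite ge_min lexx orbT.
  by move: s1_gt e0; lra.
by rewrite leNgt s1_gt.
Qed.

Lemma open_euclidean_ball A x : open A -> A x ->
  exists2 r : R, 0 < r & forall y, enorm (x - y) < r -> A y.
Proof.
move=> oA Ax; have /nbhs_ballP[r /= r0 xrA] : nbhs x A by exact: open_nbhs_nbhs.
exists r => // y xy; apply: xrA; apply: rV_ball_coord => // j.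
by apply: le_lt_trans xy; have := coord_le_enorm (x - y) j; rewrite !mxE.
Qed.

(** A ray leaves the bounded set, hence crosses its boundary.  This matters
    because the distance to an empty set is [inf set0 = 0]. *)
Lemma boundary_nonempty A : (0 < d)%N -> open A -> bounded_set A -> A !=set0 ->
  boundary A !=set0.
Proof.
move=> d0 oA bA [x Ax].
have [M M0 AM] : exists2 M : R, 0 <= M & forall y, A y -> `|y| <= M.
  case: bA => M [_ AM]; exists (Num.max 0 M + 1).
    by rewrite addr_ge0 // le_max lexx.
  by move=> y; apply: AM; rewrite (le_lt_trans (y := Num.max 0 M)) ?ltrDl // le_max lexx orbT.
pose v : 'rV[R]_d := const_mx 1; pose t := 2 * M + 1.
have t0 : 0 <= t by rewrite /t; lra.
have nAt : ~ closure A (x + t *: v).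
  move=> /(_ (ball (x + t *: v) 1)) [|y [Ay]]; first exact: nbhsx_ballx.
  rewrite mx_norm_ball /ball_ /= => xty.
  have := coord_le_norm (x + t *: v - y) (Ordinal d0); rewrite !mxE mulr1.
  have := le_trans (coord_le_norm y (Ordinal d0)) (AM y Ay).
  have := le_trans (coord_le_norm x (Ordinal d0)) (AM x Ax).
  rewrite !ler_norml; move: xty; rewrite /t; lra.
have [s [_ _ bs]] := segment_meets_boundary A x v t oA Ax t0 nAt.
by exists (x + s *: v).
Qed.

Lemma euclidean_dist_boundary_gt0 A x : (0 < d)%N -> open A -> bounded_set A ->
  A x -> 0 < euclidean_dist x (boundary A).
Proof.
move=> d0 oA bA Ax; have [r r0 xrA] := open_euclidean_ball A x oA Ax.
apply: (lt_le_trans r0); apply: lb_le_inf.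
  have [|y By] := boundary_nonempty A d0 oA bA; first by exists x.
  by exists (enorm (x - y)), y.
move=> _ [y [_ nAy] <-]; rewrite leNgt; apply/negP => /xrA Ay; apply: nAy.
exact: open_nbhs_nbhs.
Qed.

(** Otherwise the segment would cross the boundary strictly before its end, at
    a distance from [x] less than [t]. *)
Lemma closure_of_dist_boundary A x v (t : R) :
  open A -> A x -> enorm v = 1 -> 0 <= t -> t <= euclidean_dist x (boundary A) ->
  closure A (x + t *: v).
Proof.
move=> oA Ax v1 t0 tdist; apply: contrapT => nAt.
have [s [s0 st bs]] := segment_meets_boundary A x v t oA Ax t0 nAt.
have : euclidean_dist x (boundary A) <= s.
  apply: ge_inf; first by exists 0 => _ [y _ <-]; exact: enorm_ge0.
  exists (x + s *: v) => //.
  by rewrite opprD addNKr -scaleNr enormZ v1 mulr1 normrN ger0_norm.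
by move: st tdist; lra.
Qed.

End EuclideanGeometry.

(** * Barycentric coordinates *)

Section Barycentric.
Context {R : realType} {d : nat}.

Definition affine (g : 'rV[R]_d -> R) : Prop :=
  exists (a : 'cV[R]_d) (b : R), forall x, g x = (x *m a) 0 0 + b.

Lemma affine_sum {n : nat} (g : 'rV[R]_d -> R) (c : 'I_n -> R)
    (p : 'I_n -> 'rV[R]_d) :
  affine g -> \sum_i c i = 1 -> g (\sum_i c i *: p i) = \sum_i c i * g (p i).
Proof.
move=> [a [b gE]] c1; rewrite gE mulmx_suml summxE.
rewrite [RHS](eq_bigr (fun i => (c i *: p i *m a) 0 0 + c i * b)).
  by rewrite big_split /= -mulr_suml c1 mul1r.
by move=> i _; rewrite gE mulrDr -scalemxAl [in RHS]mxE.
Qed.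

Lemma affine_segment (g : 'rV[R]_d -> R) (x y : 'rV[R]_d) (s : R) :
  affine g -> g (x + s *: (y - x)) = (1 - s) * g x + s * g y.
Proof.
move=> [a [b gE]]; rewrite !gE mulmxDl -scalemxAl mulmxBl !mxE; ring.
Qed.

Lemma affine_continuous (g : 'rV[R]_d -> R) : affine g -> continuous g.
Proof.
move=> [a [b gE]]; rewrite (_ : g = fun x => (\sum_j x 0 j * a j 0) + b).
  move=> x; apply: (@cvgD _ _ _ (nbhs x)); last exact: cvg_cst.
  apply: continuous_big => [|j _ y]; first exact: add_continuous.
  by apply: (@cvgM _ _ (nbhs y)); [exact: coord_continuous | exact: cvg_cst].
by apply/funext => x; rewrite gE mxE.
Qed.

(** Barycentric coordinates with respect to the vertices in [K]; signs are left
    free, so that every point of the space has such coordinates when [K] spans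
    a full-dimensional simplex. *)
Definition barycentric {n : nat} (p : 'I_n -> 'rV[R]_d) (K : {set 'I_n})
    (x : 'rV[R]_d) (c : 'I_n -> R) : Prop :=
  [/\ forall i, i \notin K -> c i = 0, \sum_i c i = 1 & x = \sum_i c i *: p i].

Lemma barycentric_inj {n : nat} (p : 'I_n -> 'rV[R]_d) K x c c' :
  affinely_independent p K -> barycentric p K x c -> barycentric p K x c' ->
  forall i, c i = c' i.
Proof.
move=> indep [cK c1 cx] [c'K c'1 c'x] i; apply/eqP; rewrite -subr_eq0; apply/eqP.
apply: (indep (fun i => c i - c' i)) => [j jK||].
- by rewrite cK // c'K // subrr.
- by rewrite sumrB c1 c'1 subrr.
- by under eq_bigr do rewrite scalerBl; rewrite sumrB -cx -c'x subrr.
Qed.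

Lemma barycentricW {n : nat} (p : 'I_n -> 'rV[R]_d) (K L : {set 'I_n}) x c :
  K \subset L -> barycentric p K x c -> barycentric p L x c.
Proof.
move=> KL [cK c1 cx]; split=> // i iL; apply: cK.
by apply: contra iL; exact: (fintype.subsetP KL).
Qed.

Lemma barycentric_node {n : nat} (p : 'I_n -> 'rV[R]_d) (K : {set 'I_n}) i :
  i \in K -> barycentric p K (p i) (fun j => (j == i)%:R).
Proof.
move=> iK; split=> [j jK||].
- by case: eqVneq => // ji; rewrite ji iK in jK.
- by rewrite (bigD1 i) //= eqxx big1 ?addr0 // => j /negbTE ->.
- rewrite (bigD1 i) //= eqxx scale1r big1 ?addr0 // => j /negbTE ->.
  by rewrite scale0r.
Qed.

(** The square matrix [M] whose rows are the vertices, each extended by an entry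
    1, is invertible by affine independence.  Multiplying [(x, 1)] by its
    inverse gives the coordinates, which therefore are affine in [x]. *)
Lemma affine_barycentric {n : nat} (p : 'I_n -> 'rV[R]_d) (K : {set 'I_n}) :
  #|K| = d.+1 -> affinely_independent p K ->
  exists l : 'I_n -> 'rV[R]_d -> R,
    (forall i, affine (l i)) /\ forall x, barycentric p K x (l^~ x).
Proof.
move=> cardK indep.
pose e (j : 'I_#|K|) : 'I_n := enum_val j.
pose M : 'M[R]_(#|K|, d + 1) := row_mx (\matrix_j p (e j)) (const_mx 1).
(* Rows of M are numbered by 'I_#|K|; ext carries coefficients back to the
   vertex indices, with the value 0 off K. *)
pose ext (v : 'rV[R]_#|K|) (i : 'I_n) : R := \sum_j v 0 j * (i == e j)%:R.
have extK v i : i \notin K -> ext v i = 0.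
  move=> iK; rewrite /ext big1 // => j _; case: eqVneq => [ij|_]; last by rewrite mulr0.
  by rewrite ij enum_valP in iK.
have sum_ext (T : lmodType R) v (F : 'I_n -> T) :
    \sum_i ext v i *: F i = \sum_j v 0 j *: F (e j).
  under eq_bigr do rewrite scaler_suml.
  rewrite exchange_big /=; apply: eq_bigr => j _.
  rewrite (bigD1 (e j)) //= eqxx mulr1 big1 ?addr0 // => i /negbTE ->.
  by rewrite mulr0 scale0r.
have mulM v : v *m M = row_mx (\sum_i ext v i *: p i) (const_mx (\sum_i ext v i)).
  rewrite mul_mx_row sum_ext mulmx_sum_row; congr row_mx.
    by apply: eq_bigr => j _; rewrite rowK.
  apply/rowP => k; rewrite !mxE.
  have := sum_ext R^o v (fun=> 1); rewrite /GRing.scale /=.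
  under eq_bigr do rewrite mulr1.
  by move=> ->; apply: eq_bigr => j _; rewrite mxE.
have freeM : row_free M.
  apply: inj_row_free => v vM; apply/rowP => j; rewrite mxE.
  move: vM; rewrite mulM -row_mx0 => /eq_row_mx[vp v1].
  have v0 := indep (ext v) (extK v) _ vp.
  have <- : ext v (e j) = v 0 j.
    have := sum_ext R^o v (fun i => (i == e j)%:R).
    rewrite (bigD1 (e j)) //= eqxx big1 ?addr0 => [|i /negbTE ->];
      last by rewrite scaler0.
    rewrite (bigD1 j) //= eqxx big1 ?addr0 => [|i ij]; last first.
      by rewrite (inj_eq enum_val_inj) (negbTE ij) scaler0.
    by rewrite /GRing.scale /= !mulr1.
  by apply: v0; have := congr1 (fun A : 'rV_1 => A 0 0) v1; rewrite !mxE.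
have fullM : row_full M by move/eqP: freeM => rM; rewrite /row_full rM cardK addn1.
pose N := pinvmx M.
have NM : N *m M = 1%:M by exact: mulVpmx.
pose h (x : 'rV[R]_d) : 'rV_(d + 1) := row_mx x (const_mx 1).
exists (fun i x => ext (h x *m N) i); split=> [i|x]; last first.
  have := mulM (h x *m N); rewrite -mulmxA NM mulmx1 /h => /eq_row_mx[xE oneE].
  split=> //; first exact: extK.
  by have := congr1 (fun A : 'rV_1 => A 0 0) oneE; rewrite !mxE.
exists (\sum_j (i == e j)%:R *: col j (usubmx N)).
exists (\sum_j (i == e j)%:R * \sum_k dsubmx N k j) => x.
rewrite /ext /h -[N in LHS]vsubmxK mul_row_col mulmx_sumr summxE -big_split /=.
apply: eq_bigr => j _; rewrite -scalemxAr !mxE mulrC mulrDr.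
congr (_ * _ + _ * _); apply: eq_bigr => k _; rewrite !mxE //.
by rewrite mul1r.
Qed.

End Barycentric.

(** * Geometry of a conforming mesh *)

Section MeshGeometry.
Context {R : realType} {d : nat} (m : mesh R d).
Implicit Types (x : 'rV[R]_d) (K L : {set 'I_(nnodes m)}) (i : 'I_(nnodes m)).

Definition mesh_union : set 'rV[R]_d :=
  \bigcup_(K in [set K | K \in elts m]) elt K.

Lemma elt_barycentric K x : elt K x <->
  exists2 c, (forall i, 0 <= c i) & barycentric (@node R d m) K x c.
Proof.
by split=> [[c [c0 cK c1 cx]]|[c c0 [cK c1 cx]]]; exists c.
Qed.

(** Elements meet in a common face, and the coordinates with respect to that
    face are coordinates with respect to both elements; hence the values that
    two elements assign to a shared point agree. *)
Lemma barycentric_conforming K L x c c' : K \in elts m -> L \in elts m ->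
  (forall i, 0 <= c i) -> barycentric (@node R d m) K x c ->
  (forall i, 0 <= c' i) -> barycentric (@node R d m) L x c' ->
  forall i, c i = c' i.
Proof.
move=> Km Lm c0 Kc c'0 Lc'.
have [F FKL KLF] := elt_conforming Km Lm.
have : simplex (@node R d m) F x.
  by rewrite -KLF; split; apply/elt_barycentric; [exists c | exists c'].
move=> /elt_barycentric[e _ Fe] i.
have FK := fintype.subset_trans FKL (subsetIl K L).
have FL := fintype.subset_trans FKL (subsetIr K L).
rewrite (barycentric_inj _ _ _ _ _ (elt_indep Km) Kc (barycentricW _ _ _ _ _ FK Fe)).
exact: (barycentric_inj _ _ _ _ _ (elt_indep Lm) (barycentricW _ _ _ _ _ FL Fe) Lc').
Qed.

Lemma node_in_union i : mesh_union (node i).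
Proof.
have [K Km iK] := node_in_elt i; exists K => //.
apply/elt_barycentric; exists (fun j => (j == i)%:R); last exact: barycentric_node.
by move=> j; exact: ler0n.
Qed.

(** Affine inequalities make an element visibly closed and give access to its
    interior points and to the affine functions on it. *)
Lemma elt_affineP K : K \in elts m -> exists l : 'I_(nnodes m) -> 'rV[R]_d -> R,
  [/\ forall i, affine (l i), forall x, barycentric (@node R d m) K x (l^~ x) &
      forall x, elt K x <-> forall i, 0 <= l i x].
Proof.
move=> Km; have [l [la lb]] :=
  affine_barycentric (@node R d m) K (elt_card Km) (elt_indep Km).
exists l; split=> // x; split=> [/elt_barycentric[c c0 Kc] i|l0].
  by rewrite (barycentric_inj _ _ _ _ _ (elt_indep Km) (lb x) Kc).
by apply/elt_barycentric; exists (l^~ x).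
Qed.

Lemma closed_elt K : K \in elts m -> closed (elt K).
Proof.
move=> Km; have [l [la _ lK]] := elt_affineP K Km.
rewrite (_ : elt K = \bigcap_(i in [set: 'I_(nnodes m)]) [set x | 0 <= l i x]).
  apply: closed_bigI => i _.
  have /continuous_closedP/(_ [set t | 0 <= t]) := affine_continuous _ (la i).
  by apply; exact: closed_ge.
apply/seteqP; split=> x; first by move=> /lK lx i _; exact: lx.
by move=> lx; apply/lK => i; exact: lx.
Qed.

Lemma closed_mesh_union : closed mesh_union.
Proof.
by apply: closed_bigcup; [exact: finite_finset | exact: closed_elt].
Qed.

Lemma Omega_h_sub_union : Omega_h m `<=` mesh_union.
Proof. exact: interior_subset. Qed.

Lemma open_Omega_h : open (Omega_h m).
Proof. exact: open_interior. Qed.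

(** A point of an element is the limit, along the segment towards the centroid,
    of points with positive coordinates, which are interior. *)
Lemma closure_Omega_h : closure (Omega_h m) = mesh_union.
Proof.
apply/seteqP; split=> [x|x [K /= Km Kx]].
  move/(closure_subset Omega_h_sub_union).
  by rewrite -(proj1 (closure_id _) closed_mesh_union).
have [l [la lb lK]] := elt_affineP K Km.
(* Coordinates off K vanish identically, so positivity on K is an open
   condition under which a point belongs to the element. *)
have posO y : (forall i, i \in K -> 0 < l i y) -> Omega_h m y.
  move=> ly; rewrite /Omega_h /interior.
  have near_pos i : \forall z \near y, i \in K -> 0 < l i z.
    have [iK|iK] := boolP (i \in K); last by apply: filterE => z.
    have /continuousP/(_ [set t | 0 < t]) := affine_continuous _ (la i).
    move=> /(_ ltac:(exact: open_gt)) oi; have := open_nbhs_nbhs (conj oi (ly i iK)).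
    by apply: filterS => z.
  apply: filterS (filter_forall _ near_pos) => z lz; exists K => //.
  apply/lK => i; have [iK|iK] := boolP (i \in K); first exact/ltW/lz.
  by have [-> //] := lb z.
pose g : 'rV[R]_d := \sum_i ((i \in K)%:R / d.+1%:R) *: node i.
have gK : barycentric (@node R d m) K g (fun i => (i \in K)%:R / d.+1%:R).
  split=> // [i /negbTE ->|]; first by rewrite mul0r.
  by rewrite -mulr_suml -natr_sum -big_mkcond sum1_card (elt_card Km) divff ?pnatr_eq0.
move=> N Nx.
have : nbhs (x + 0 *: (g - x)) N by rewrite scale0r addr0.
move=> /continuous_line/nbhs_ballP[e /= e0 eN].
pose s := Num.min (e / 2) (1 / 2).
have s0 : 0 < s by rewrite lt_min !divr_gt0.
have se : s <= e / 2 by rewrite ge_min lexx.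
have s1 : s <= 1 / 2 by rewrite ge_min lexx orbT.
exists (x + s *: (g - x)); split; last first.
  by apply: eN; rewrite /ball /= ltr_norml; lra.
apply: posO => i iK; rewrite affine_segment //.
have := proj1 (lK x) Kx i.
have -> : l i g = d.+1%:R^-1.
  by rewrite (barycentric_inj _ _ _ _ _ (elt_indep Km) (lb g) gK) iK mul1r.
have := invr_gt0 (d.+1%:R : R); rewrite ltr0n => d0 lix.
by apply: ltr_wpDl; rewrite ?mulr_gt0 ?mulr_ge0 //; lra.
Qed.

Lemma norm_mesh_union : exists M : R, forall x : 'rV[R]_d, mesh_union x -> `|x| <= M.
Proof.
exists (\sum_i `|node (m:=m) i|) => x [K Km /elt_barycentric[c c0 [cK c1 ->]]].
apply: le_trans (ler_norm_sum _ _ _) _; apply: ler_sum => i _.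
rewrite normrZ ger0_norm // ler_piMl //.
by rewrite -c1 (bigD1 i) //= lerDl sumr_ge0.
Qed.

Lemma bounded_Omega_h : bounded_set (Omega_h m).
Proof.
have [M UM] := norm_mesh_union; exists M; split; first exact: num_real.
by move=> r Mr x /Omega_h_sub_union /UM /le_trans; apply; exact: ltW.
Qed.

Lemma mesh_size_gt0 i : (0 < d)%N -> 0 < mesh_size m.
Proof.
move=> d0; have [K Km iK] := node_in_elt i.
have /card_gt0P[j] : (0 < #|K :\ i|)%N.
  by have := elt_card Km; rewrite (cardsD1 i) iK add1n => -[->].
rewrite in_setD1 => /andP[ji jK].
have elt_node k : k \in K -> elt K (node k).
  move=> kK; apply/elt_barycentric; exists (fun j => (j == k)%:R).
    by move=> l; exact: ler0n.
  exact: barycentric_node.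
have ij0 : 0 < enorm (node i - node j).
  have /eqP : node i <> node j by move/node_inj => ij; rewrite ij eqxx in ji.
  rewrite -subr_eq0 => /rV0Pn[k]; rewrite -normr_gt0 => /lt_le_trans; apply.
  exact: coord_le_enorm.
apply: (lt_le_trans ij0); apply: (@le_trans _ _ (ediam (elt K))); last first.
  by rewrite /mesh_size (bigD1 K) //= le_max lexx.
have [M UM] := norm_mesh_union.
apply: ub_le_sup; last by exists (node i); [exact: elt_node|exists (node j); [exact: elt_node|]].
exists (Num.sqrt d%:R * (M + M)) => _ [x Kx [y Ky <-]].
apply: le_trans (enorm_le_norm _) _; rewrite ler_wpM2l ?sqrtr_ge0 //.
by apply: le_trans (ler_normB _ _) _; apply: lerD; apply: UM; exists K.
Qed.

End MeshGeometry.

(** * Nodal interpolation *)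

Section Interpolation.
Context {R : realType} {d : nat} (m : mesh R d).
Implicit Types (x : 'rV[R]_d) (K : {set 'I_(nnodes m)}) (i : 'I_(nnodes m)).

(** The values at a point of the nodal (hat) basis functions of the finite
    element space.  Outside the mesh the set is empty and the value is 0. *)
Definition nodal_weight x : 'I_(nnodes m) -> R :=
  xget (fun=> 0) [set c | (forall i, 0 <= c i) /\
    exists2 K, K \in elts m & barycentric (@node R d m) K x c].

Lemma nodal_weightE K x c : K \in elts m -> (forall i, 0 <= c i) ->
  barycentric (@node R d m) K x c -> forall i, nodal_weight x i = c i.
Proof.
move=> Km c0 Kc i; rewrite /nodal_weight; case: xgetP => [e _ [e0 [L Lm Le]]|].
  exact: (barycentric_conforming m L K x).
by move=> /(_ c) []; split=> //; exists K.
Qed.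

Lemma nodal_weightP x : mesh_union m x ->
  exists K, [/\ K \in elts m, elt K x, forall i, 0 <= nodal_weight x i &
    barycentric (@node R d m) K x (nodal_weight x)].
Proof.
move=> [K Km Kx]; have /elt_barycentric[c c0 Kc] := Kx; exists K.
have wE := nodal_weightE K x c Km c0 Kc.
have -> : nodal_weight x = c by apply/funext.
by split.
Qed.

Definition interpolant (w : 'I_(nnodes m) -> R) x : R :=
  \sum_i nodal_weight x i * w i.

Lemma interpolant_node w i : interpolant w (node i) = w i.
Proof.
have [K Km iK] := node_in_elt i.
rewrite /interpolant (bigD1 i) //= big1 => [|j /negbTE ji].
  by rewrite (nodal_weightE K _ _ Km _ (barycentric_node _ _ _ iK)) ?eqxx ?mul1r ?addr0.
by rewrite (nodal_weightE K _ _ Km _ (barycentric_node _ _ _ iK)) ?ji ?mul0r.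
Qed.

Lemma interpolant_affine_on w K : K \in elts m ->
  exists2 g, affine g & forall x, elt K x -> interpolant w x = g x.
Proof.
move=> Km; have [l [la lb lK]] := elt_affineP m K Km.
exists (fun x => \sum_i l i x * w i) => [|x Kx]; last first.
  apply: eq_bigr => i _; congr (_ * _).
  by apply: nodal_weightE Km _ (lb x) _; exact/lK.
have /choice[a /choice[b lE]] := la.
exists (\sum_i w i *: a i), (\sum_i w i * b i) => x.
rewrite mulmx_sumr summxE -big_split /=; apply: eq_bigr => i _.
by rewrite lE -scalemxAr [in RHS]mxE; ring.
Qed.

(** On each of the finitely many closed elements the interpolant is affine, so
    the pieces glue to a continuous function. *)
Lemma V_h_interpolant w : V_h m (interpolant w).
Proof.
split; last first.
  move=> K Km; have [g [a [b gE]] wg] := interpolant_affine_on w K Km.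
  by exists a, b => x Kx; rewrite wg.
have sE : \big[setU/set0]_(K <- enum (elts m)) elt K = mesh_union m.
  rewrite -bigcup_seq; apply/seteqP; split=> x [K Km Kx]; exists K => //;
    by move: Km; rewrite /= mem_enum.
rewrite closure_Omega_h -sE.
have : {subset enum (elts m) <= elts m} by move=> K; rewrite mem_enum.
elim: (enum _) => [|K s IH] sm; first by rewrite big_nil; exact: continuous_subspace0.
rewrite big_cons; have Km : K \in elts m by rewrite sm ?mem_head.
have {}sm : {subset s <= elts m} by move=> L Ls; rewrite sm // inE Ls orbT.
apply: withinU_continuous; last exact: IH.
- exact: closed_elt.
- by apply: closed_bigsetU => L /sm; exact: closed_elt.
have [g ga wg] := interpolant_affine_on w K Km.
apply: (@subspace_eq_continuous _ _ _ g) => [x|]; first by rewrite inE => /wg.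
exact/continuous_subspaceT/affine_continuous.
Qed.

(** Functions of the finite element space are thus determined by their nodal
    values, which reduces the discrete problem to finitely many unknowns. *)
Lemma V_h_interpolantE (u : 'rV[R]_d -> R) x :
  V_h m u -> mesh_union m x -> u x = interpolant (u \o @node R d m) x.
Proof.
move=> [_ uV] /nodal_weightP[K [Km Kx c0 Kc]].
have [a [b uE]] := uV K Km; rewrite uE //; case: Kc => cK c1 xE.
rewrite [in LHS]xE; have /affine_sum -> // : affine (fun y => (y *m a) 0 0 + b).
  by exists a, b.
apply: eq_bigr => i _ /=; have [iK|iK] := boolP (i \in K).
  rewrite uE //; apply/elt_barycentric; exists (fun j => (j == i)%:R).
    by move=> j; exact: ler0n.
  exact: barycentric_node.
by rewrite cK // !mul0r.
Qed.

Lemma interpolant_le w x (M : R) :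
  mesh_union m x -> (forall i, `|w i| <= M) -> `|interpolant w x| <= M.
Proof.
move=> /nodal_weightP[K [_ _ c0 [_ c1 _]]] wM.
rewrite -[M]mul1r -c1 mulr_suml; apply: le_trans (ler_norm_sum _ _ _) _.
by apply: ler_sum => i _; rewrite normrM ger0_norm // ler_wpM2l.
Qed.

(** Jensen's inequality for the nodal weights, one coordinate at a time. *)
Lemma interpolant_enorm_sqr x : mesh_union m x ->
  enorm x ^+ 2 <= interpolant (fun i => enorm (node i) ^+ 2) x.
Proof.
move=> /nodal_weightP[K [_ _ c0 [_ c1 xE]]].
rewrite /interpolant enorm_sqr; under [leRHS]eq_bigr do rewrite enorm_sqr mulr_sumr.
rewrite exchange_big /=; apply: ler_sum => k _.
apply: le_trans (sqr_mean_le _ (fun i => node i 0 k) c0 c1).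
by rewrite {1}xE summxE; under eq_bigr do rewrite mxE.
Qed.

End Interpolation.

(** * The discrete problem *)

Section DiscreteProblem.
Context {R : realType} {d : nat} (d_gt0 : (0 < d)%N) (m : mesh R d)
  (Omega : set 'rV[R]_d) (delta : R) (S : {fset 'rV[R]_d})
  (f : 'rV[R]_d -> R).
Hypothesis boundary_nodes : forall i : 'I_(nnodes m),
  boundary (Omega_h m) (node i) -> boundary Omega (node i).
Hypothesis delta_ge_h : mesh_size m <= delta.
Hypothesis S_unit : forall v, v \in S -> unit_sphere v.
Implicit Types (i : 'I_(nnodes m)) (v : 'rV[R]_d).

Let inner := @interior_node R d m Omega.

Lemma interior_node_in_Omega_h i : inner i -> Omega_h m (node i).
Proof.
move=> ii; apply: contrapT => nO; apply: ii; apply: boundary_nodes; split.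
  by rewrite closure_Omega_h; exact: node_in_union.
by move=> /interior_subset.
Qed.

Lemma delta_node_gt0 i : inner i -> 0 < delta_node delta i.
Proof.
move=> ii; rewrite lt_min (lt_le_trans (mesh_size_gt0 m i d_gt0)) //=.
apply: euclidean_dist_boundary_gt0 => //; first exact: open_Omega_h.
  exact: bounded_Omega_h.
exact: interior_node_in_Omega_h.
Qed.

(** The sign [s] is for treating both ends of a stencil at once. *)
Lemma stencil_in_union i v (s : R) : inner i -> v \in S -> `|s| = 1 ->
  mesh_union m (node i + (s * delta_node delta i) *: v).
Proof.
move=> ii vS s1; rewrite -closure_Omega_h mulrC -scalerA.
apply: closure_of_dist_boundary.
- exact: open_Omega_h.
- exact: interior_node_in_Omega_h.
- by rewrite enormZ s1 mul1r; exact: S_unit.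
- exact/ltW/delta_node_gt0.
- by rewrite ge_min lexx orbT.
Qed.

Lemma stencilP i v : inner i -> v \in S ->
  mesh_union m (node i + delta_node delta i *: v) /\
  mesh_union m (node i - delta_node delta i *: v).
Proof.
move=> ii vS; have [] := (stencil_in_union i v 1 ii vS (normr1 _),
  stencil_in_union i v (- 1) ii vS (normrN1 _)).
by rewrite mul1r mulN1r scaleNr.
Qed.

Definition stencil_weight i v j : R :=
  (nodal_weight m (node i + delta_node delta i *: v) j +
   nodal_weight m (node i - delta_node delta i *: v) j) / 2.

Lemma stencil_weight_sum i v (w : 'I_(nnodes m) -> R) :
  \sum_j stencil_weight i v j * w j =
  (interpolant m w (node i + delta_node delta i *: v) +
   interpolant m w (node i - delta_node delta i *: v)) / 2.
Proof.
rewrite /interpolant -big_split mulr_suml /=; apply: eq_bigr => j _.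
by rewrite /stencil_weight; ring.
Qed.

Lemma stencil_weight_ge0 i v j : inner i -> v \in S -> 0 <= stencil_weight i v j.
Proof.
move=> ii vS; have [/nodal_weightP[_ [_ _ p0 _]] /nodal_weightP[_ [_ _ q0 _]]] :=
  stencilP i v ii vS.
by rewrite divr_ge0 // addr_ge0.
Qed.

Lemma stencil_weight_sum1 i v : inner i -> v \in S -> \sum_j stencil_weight i v j = 1.
Proof.
move=> ii vS.
have [/nodal_weightP[_ [_ _ _ [_ p1 _]]] /nodal_weightP[_ [_ _ _ [_ q1 _]]]] :=
  stencilP i v ii vS.
by rewrite -mulr_suml big_split /= p1 q1 divff.
Qed.

(** By the parallelogram identity the average of [|.|^2] over the two ends of
    a stencil exceeds its value at the node by [delta_node delta i ^+ 2], and
    interpolation only increases the average. *)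
Lemma enorm_sqr_stencil i v : inner i -> v \in S ->
  enorm (node i) ^+ 2 < \sum_j stencil_weight i v j * enorm (node j) ^+ 2.
Proof.
move=> ii vS; have [p q] := stencilP i v ii vS; rewrite stencil_weight_sum.
have := interpolant_enorm_sqr m _ p; have := interpolant_enorm_sqr m _ q.
set P := interpolant _ _ _; set Q := interpolant _ _ _ => Qle Ple.
have d0 : 0 < delta_node delta i ^+ 2 by rewrite exprn_gt0 // delta_node_gt0.
have parallelogram : enorm (node i + delta_node delta i *: v) ^+ 2 +
    enorm (node i - delta_node delta i *: v) ^+ 2 =
    2 * (enorm (node i) ^+ 2 + delta_node delta i ^+ 2 * enorm v ^+ 2).
  rewrite !enorm_sqr -big_split /= mulr_sumr -big_split mulr_sumr /=.
  by apply: eq_bigr => j _; rewrite !mxE; ring.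
move: parallelogram; rewrite (S_unit v vS); lra.
Qed.

Definition discrete_step := obstacle_step inner S stencil_weight (f \o @node R d m).

(** At an interior node, [nabla2] is a positive multiple of the difference
    between the stencil average and the central value; so the minimum of the
    scheme vanishes iff the central value is the minimum of [f] and of the
    averages. *)
Lemma discrete_solutionE u : V_h m u ->
  discrete_solution m Omega delta S f u <->
  forall i, discrete_step (u \o @node R d m) i = u (node i).
Proof.
move=> uV.
have Tstep i : inner i -> T_eps delta S u f i = 0 <->
    \big[Num.min/f (node i)]_(v <- S) (\sum_j stencil_weight i v j * u (node j)) =
    u (node i).
  move=> ii; have d0 : 0 < delta_node delta i ^+ 2.
    by rewrite exprn_gt0 // delta_node_gt0.
  have nabla2E v : v \in S -> nabla2 delta u i v =
      2 / delta_node delta i ^+ 2 *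
      (\sum_j stencil_weight i v j * u (node j) - u (node i)).
    move=> vS; have [p q] := stencilP i v ii vS.
    rewrite (stencil_weight_sum i v (u \o @node R d m)).
    rewrite -(V_h_interpolantE m u _ uV p) -(V_h_interpolantE m u _ uV q) /nabla2.
    by field; rewrite gt_eqF // delta_node_gt0.
  have c0 : 0 < 2 / delta_node delta i ^+ 2 by rewrite divr_gt0.
  split=> /eqP; rewrite eq_le => /andP[/bigmin_seq_leP le0 /bigmin_seqP[ge_f ge_S]].
    apply/le_anti/andP; split.
      apply/bigmin_seq_leP; case: le0 => [|[v vS]]; first by left; lra.
      by rewrite nabla2E // pmulr_rle0 // subr_le0; right; exists v.
    apply/bigmin_seqP; split=> [|v vS]; first by lra.
    by have := ge_S v vS; rewrite nabla2E // pmulr_rge0 // subr_ge0.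
  apply/le_anti/andP; split.
    apply/bigmin_seq_leP; case: le0 => [|[v vS le_v]]; first by left; lra.
    by right; exists v => //; rewrite nabla2E // pmulr_rle0 // subr_le0.
  apply/bigmin_seqP; split=> [|v vS]; first by lra.
  by rewrite nabla2E // pmulr_rge0 // subr_ge0; exact: ge_S.
rewrite /discrete_step /obstacle_step; split=> [[_ Tu bu] i|uG].
  case: asboolP => [ii|/contrapT bi] /=; last by rewrite bu.
  by apply/Tstep/Tu.
split=> // i; first by move=> ii; have := uG i; rewrite (asboolT ii) => /Tstep; apply.
by move=> bi; have := uG i; rewrite asboolF //; exact.
Qed.

Lemma step_comparison (w u : 'I_(nnodes m) -> R) :
  (forall i, w i <= discrete_step w i) -> (forall i, discrete_step u i <= u i) ->
  forall i, w i <= u i.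
Proof.
apply: (obstacle_step_comparison inner S stencil_weight _ stencil_weight_ge0
  stencil_weight_sum1 (fun i => enorm (node i) ^+ 2)).
exact: enorm_sqr_stencil.
Qed.

Lemma discrete_solution_exists : exists u, discrete_solution m Omega delta S f u.
Proof.
have [w wG] := obstacle_step_fixpoint inner S stencil_weight (f \o @node R d m)
  stencil_weight_ge0 stencil_weight_sum1.
exists (interpolant m w); apply/discrete_solutionE; first exact: V_h_interpolant.
have -> : interpolant m w \o @node R d m = w.
  by apply/funext => i; exact: interpolant_node.
by move=> i; rewrite interpolant_node; exact: wG.
Qed.

Lemma discrete_solution_unique u u' :
  discrete_solution m Omega delta S f u -> discrete_solution m Omega delta S f u' ->
  forall x, closure (Omega_h m) x -> u' x = u x.
Proof.
move=> su su' x; rewrite closure_Omega_h => Ux.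
have [[uV _ _] [u'V _ _]] := (su, su').
rewrite (V_h_interpolantE m u) // (V_h_interpolantE m u') //.
have [/discrete_solutionE-/(_ uV) uG /discrete_solutionE-/(_ u'V) u'G] := (su, su').
congr interpolant; apply/funext => i; apply/le_anti/andP; split;
  by apply: (step_comparison (_ \o @node R d m) (_ \o @node R d m)) => j;
    rewrite ?uG ?u'G.
Qed.

(** The obstacle bounds the solution from above, and the constant [- M] is a
    subsolution. *)
Lemma discrete_solution_bounded u (M : R) :
  discrete_solution m Omega delta S f u -> (forall i, `|f (node i)| <= M) ->
  forall x, closure (Omega_h m) x -> `|u x| <= M.
Proof.
move=> su fM x; rewrite closure_Omega_h => Ux; have [uV _ _] := su.
rewrite (V_h_interpolantE m u) //; apply: interpolant_le => // i /=.
have /discrete_solutionE-/(_ uV) uG := su.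
rewrite ler_norml; apply/andP; split; last first.
  rewrite -uG; apply: le_trans (obstacle_step_le _ _ _ _ _ _) _.
  exact: le_trans (ler_norm _) (fM i).
apply: (step_comparison (fun=> - M) (u \o @node R d m)) => j; last by rewrite uG.
apply: (obstacle_step_cst inner S _ _ stencil_weight_sum1) => k /=.
by have := fM k; rewrite ler_norml => /andP[].
Qed.

End DiscreteProblem.

(** * Essential bounds of continuous functions *)

Section EssentialBound.
Context {R : realType} {d : nat}.

Lemma lebesgue_null_subset (A B : set 'rV[R]_d) :
  A `<=` B -> lebesgue_null B -> lebesgue_null A.
Proof.
move=> AB nB e e0; have [a [b [ab Bc vol]]] := nB e e0.
by exists a, b; split=> //; exact: subset_trans Bc.
Qed.

(** The empty set is covered by degenerate boxes, whose volume vanishes only in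
    positive dimension. *)
Lemma lebesgue_null_set0 : (0 < d)%N -> lebesgue_null (set0 : set 'rV[R]_d).
Proof.
move=> d0 e e0; exists (fun=> 0), (fun=> 0); split=> //.
rewrite eseries0 ?lee_fin ?ltW // => k _ _.
by rewrite (bigD1 (Ordinal d0)) //= subrr mul0r.
Qed.

(** If the bound failed at a point of the closure, by continuity it would fail
    on a nonempty open subset of [Omega], which is not a null set. *)
Lemma essential_bound_closure (Omega : set 'rV[R]_d) (f : 'rV[R]_d -> R) (M : R) :
  open Omega -> {within closure Omega, continuous f} ->
  lebesgue_null (Omega `&` [set x | M < `|f x|]) ->
  forall x, closure Omega x -> `|f x| <= M.
Proof.
move=> oO fc nullM x clx; rewrite leNgt; apply/negP => Mfx.
have fx := (proj1 (subspace_continuousP _ _) fc) x clx.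
have /= near_x : within (closure Omega) (nbhs x) [set y | M < `|f y|].
  have nM : nbhs `|f x| [set t | M < t] by apply: open_nbhs_nbhs; split => //; exact: open_gt.
  exact: (cvg_norm fx nM).
pose N := interior [set y | closure Omega y -> M < `|f y|].
have [y [Oy Ny]] := clx N (nbhs_interior near_x).
have : Omega `&` N = set0.
  apply: open_lebesgue_null; first by apply: openI => //; exact: open_interior.
  apply: lebesgue_null_subset nullM => z [Oz /interior_subset Nz].
  by split=> //; apply: Nz; exact: subset_closure.
by move=> ON0; rewrite -[False]/(set0 y) -ON0.
Qed.

End EssentialBound.

(** * Existence, uniqueness and stability *)

Theorem lemma2p3 (R : realType) (d : nat) (d_gt0 : (0 < d)%N)
    (Omega : set 'rV[R]_d)
    (Omega_open : open Omega)
    (Omega_bounded : bounded_set Omega)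
    (Omega_strictly_convex : strictly_convex Omega)
    (f : 'rV[R]_d -> R)
    (f_continuous : {within closure Omega, continuous f})
    (m : mesh R d)
    (sigma : R) (m_shape_regular : shape_regular m sigma)
    (c : R) (m_quasi_uniform : quasi_uniform m c)
    (Omega_h_sub : Omega_h m `<=` Omega)
    (Omega_h_convex : convex_set (Omega_h m))
    (boundary_nodes : forall i : 'I_(nnodes m),
      boundary (Omega_h m) (node i) -> boundary Omega (node i))
    (delta : R) (delta_ge_h : mesh_size m <= delta)
    (theta : R) (S_theta : {fset 'rV[R]_d})
    (S_theta_sub : forall v, v \in S_theta -> unit_sphere v)
    (S_theta_cover : forall v, unit_sphere v ->
      exists2 v', v' \in S_theta & enorm (v - v') <= theta) :
  (exists u : 'rV[R]_d -> R,
     discrete_solution m Omega delta S_theta f u /\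
     forall u' : 'rV[R]_d -> R,
       discrete_solution m Omega delta S_theta f u' ->
       forall x, closure (Omega_h m) x -> u' x = u x) /\
  (forall u : 'rV[R]_d -> R,
     discrete_solution m Omega delta S_theta f u ->
     (Linf_norm (Omega_h m) u <= Linf_norm Omega f)%E).
Proof.
have node_closure (i : 'I_(nnodes m)) : closure Omega (node i).
  apply: (closure_subset Omega_h_sub); rewrite closure_Omega_h.
  exact: node_in_union.
split.
  have [u su] := discrete_solution_exists d_gt0 m Omega delta S_theta f
    boundary_nodes delta_ge_h S_theta_sub.
  exists u; split=> // u' su'.
  exact: (discrete_solution_unique d_gt0 m Omega delta S_theta f
    boundary_nodes delta_ge_h S_theta_sub).
move=> u su; apply: le_ereal_inf_tmp => _ [M [M0 nullM] <-].
apply: ereal_inf_lbound; exists M => //; split=> //.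
rewrite (_ : _ `&` _ = set0); first exact: lebesgue_null_set0.
apply/seteqP; split=> // x [Ox /=]; rewrite ltNge => /negP; apply.
apply: (discrete_solution_bounded d_gt0 m Omega delta S_theta f
  boundary_nodes delta_ge_h S_theta_sub u M su); last exact: subset_closure.
by move=> i; apply: (essential_bound_closure Omega f M).
Qed.
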